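(* Suppose that Assumption $(L)$-a.e. holds for the trajectory set $\mathcal{S}$, and let $(f_j)_{j\ge 0}$ be a sequence of non-anticipative real-valued functions $f_j:\mathcal{S}\to\mathbb{R}$. Then the following assertions are equivalent: (i) $(f_j)_{j\ge 0}$ is a supermartingale, i.e. for every $j\ge 0$ one has $\overline{\sigma}_j f_{j+1}\le f_j$ a.e. (ii) There is a null set $N_f\subseteq\mathcal{S}$ such that for every sequence $(\delta_j)_{j\ge 0}$ of positive real numbers there are sequences $(H_j)_{j\ge 0}$ and $(A_j)_{j\ge 0}$ of non-anticipative real-valued functions on $\mathcal{S}$ such that $(A_j)_{j\ge 0}$ is nondecreasing in $j$, $A_0=0$, and $$f_i(S)=f_0+\sum_{j=0}^{i-1}H_j(S)\,\Delta_jS-A_i(S)+\sum_{j=0}^{i-1}\delta_j$$ for every $S\in\mathcal{S}\setminus N_f$ and every $i\ge 0$. (The null set $N_f$ does not depend on $(\delta_j)_{j\ge 0}$.)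
   Context: Trajectories and nodes. Fix $s_0\in\mathbb{R}$ and a trajectory set $\mathcal{S}$, i.e. a set of real sequences $S=(S_i)_{i\ge 0}$ with $S_0=s_0$. For $S\in\mathcal{S}$ and $j\ge 0$ let $\mathcal{S}_{(S,j)}=\{\tilde S\in\mathcal{S}:\tilde S_i=S_i,\ 0\le i\le j\}$; the pair $(S,j)$ (identified with $\mathcal{S}_{(S,j)}$) is called a node. Write $\Delta_iS=S_{i+1}-S_i$. A sequence $(f_j)_{j\ge0}$ of functions on $\mathcal{S}$ is non-anticipative if $f_j(S)=f_j(\tilde S)$ whenever $S_i=\tilde S_i$ for $0\le i\le j$ (so $f_0$ is a constant). Portfolios. $\mathcal{H}_{(S,j)}$ is the set of sequences $H=(H_i)_{i\ge j}$ of functions $H_i:\mathcal{S}_{(S,j)}\to\mathbb{R}$ such that $H_i(\tilde S)=H_i(\hat S)$ whenever $\tilde S_k=\hat S_k$ for $j\le k\le i$ (no measurability is required). For $V\in\mathbb{R}$, $H\in\mathcal{H}_{(S,j)}$, $n\ge j$, put $\Pi_{j,n}^{V,H}(\tilde S)=V+\sum_{i=j}^{n-1}H_i(\tilde S)\Delta_i\tilde S$ for $\tilde S\in\mathcal{S}_{(S,j)}$. $\mathcal{E}_{(S,j)}$ is the vector space of all functions $\Pi_{j,n}^{V,H}$ on $\mathcal{S}_{(S,j)}$ ($V\in\mathbb{R}$, $H\in\mathcal{H}_{(S,j)}$, $n$ an integer $\ge j$), and $\mathcal{E}_{(S,j)}^+$ is the set of its nonnegative elements. Operators. $Q$ is the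 set of all functions $\mathcal{S}\to[-\infty,\infty]$ and $P$ the set of all functions $\mathcal{S}\to[0,\infty]$. Conventions: $0\cdot\infty=0$, $\infty+(-\infty)=\infty$, $u-v=u+(-v)$, $\inf\emptyset=\infty$. For $f\in P$, $\overline{I}_jf(S)$ is the infimum of all $\sum_{m\ge1}V^m$ for which there are $H^m\in\mathcal{H}_{(S,j)}$ with $\Pi_{j,n}^{V^m,H^m}\in\mathcal{E}^+_{(S,j)}$ for all $n\ge j$, $m\ge 1$, and $f\le\sum_{m\ge1}\liminf_{n\to\infty}\Pi_{j,n}^{V^m,H^m}$ on $\mathcal{S}_{(S,j)}$. Write $\overline{I}=\overline{I}_0$ (a constant). $E\subseteq\mathcal{S}$ is a null set if $\overline{I}(\mathbf{1}_E)=0$; a property holds a.e. if it fails only on a null set. For $f\in Q$, $\overline{\sigma}_jf(S)$ is the infimum of all $\sum_{m\ge0}V^m$ for which $f\le\sum_{m\ge0}f_m$ on $\mathcal{S}_{(S,j)}$, where $f_0=\Pi_{j,n_0}^{V^0,H^0}\in\mathcal{E}_{(S,j)}$ for some $n_0$ and, for $m\ge1$, $f_m=\liminf_{n\to\infty}\Pi_{j,n}^{V^m,H^m}$ with $\Pi_{j,n}^{V^m,H^m}\in\mathcal{E}^+_{(S,j)}$ for all $n\ge j$. Property $(L_{(S,j)})$: whenever $f=\Pi_{j,n_f}^{V,H}\in\mathcal{E}_{(S,j)}$ and $f_m=\liminf_{n\to\infty}\Pi_{j,n}^{V^m,H^m}$ with $\Pi_{j,n}^{V^m,H^m}\in\mathcal{E}^+_{(S,j)}$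 for all $n\ge j$, $m\ge1$, satisfy $f\le\sum_{m\ge1}f_m$ on $\mathcal{S}_{(S,j)}$, then $V\le\sum_{m\ge1}V^m$. Property $(L)$ is $(L_{(S,0)})$ (independent of $S$). Assumption $(L)$-a.e. means: $(L)$ holds, and $\{S\in\mathcal{S}:\exists j\ge0\text{ such that }(L_{(S,j)})\text{ fails}\}$ is a null set. *)

(* Defs.v *)
From HB Require Import structures.
From mathcomp Require Import all_boot all_order all_algebra.
From mathcomp Require Import all_classical all_reals all_analysis.

Set Implicit Arguments.
Unset Strict Implicit.
Unset Printing Implicit Defensive.

Import Order.TTheory GRing.Theory Num.Theory.
Import numFieldNormedType.Exports.

Local Open Scope classical_set_scope.
Local Open Scope ring_scope.
Local Open Scope ereal_scope.

(* Functions on a set of trajectories are represented by total functions on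
   nat -> R; every definition below only looks at their values on that set. *)

Section Trajectories.
Variable R : realType.
Implicit Types (calS D E : set (nat -> R)) (S T : nat -> R) (j n : nat).

Definition trajectory_set (s0 : R) calS := forall S, calS S -> S 0%N = s0.

Definition node calS S j : set (nat -> R) :=
  [set T | calS T /\ forall i, (i <= j)%N -> T i = S i].

Definition non_anticipative calS (f : nat -> (nat -> R) -> R) :=
  forall j S T, calS S -> calS T ->
    (forall i, (i <= j)%N -> S i = T i) -> f j S = f j T.

(* From here on (D, j) stands for a node: D is meant to be [node calS S j],
   in particular D = calS for j = 0. *)

Definition portfolio D j (H : nat -> (nat -> R) -> R) :=
  forall i S T, (j <= i)%N -> D S -> D T ->
    (forall k, (j <= k <= i)%N -> S k = T k) -> H i S = H i T.

Definition wealth j n (V : R) (H : nat -> (nat -> R) -> R) (S : nat -> R) : R :=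
  (V + \sum_(j <= i < n) H i S * (S i.+1 - S i))%R.

Definition elementary D j : set ((nat -> R) -> R) :=
  [set g | exists V H n, [/\ portfolio D j H, (j <= n)%N &
                          forall S, D S -> g S = wealth j n V H S]].

Definition elementary_pos D j : set ((nat -> R) -> R) :=
  [set g | elementary D j g /\ forall S, D S -> (0 <= g S)%R].

Definition admissible D j (V : R) (H : nat -> (nat -> R) -> R) :=
  portfolio D j H /\
  forall n, (j <= n)%N -> elementary_pos D j (wealth j n V H).

Definition liminf_wealth j (V : R) (H : nat -> (nat -> R) -> R) S : \bar R :=
  limn_einf (fun n => (wealth j n V H S)%:E).

Definition Ibar_node D j (f : (nat -> R) -> \bar R) : \bar R :=
  ereal_inf [set v | exists (V : nat -> R) (H : nat -> nat -> (nat -> R) -> R),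
    [/\ forall m, (1 <= m)%N -> admissible D j (V m) (H m),
        forall S, D S ->
          f S <= \sum_(1 <= m <oo) liminf_wealth j (V m) (H m) S &
        v = \sum_(1 <= m <oo) (V m)%:E]].

Definition sigma_node D j (f : (nat -> R) -> \bar R) : \bar R :=
  ereal_inf [set v | exists (V : nat -> R) (H : nat -> nat -> (nat -> R) -> R)
                            (n0 : nat),
    [/\ portfolio D j (H 0%N) /\ (j <= n0)%N,
        forall m, (1 <= m)%N -> admissible D j (V m) (H m),
        forall S, D S ->
          f S <= (wealth j n0 (V 0%N) (H 0%N) S)%:E +
                 \sum_(1 <= m <oo) liminf_wealth j (V m) (H m) S &
        v = \sum_(0 <= m <oo) (V m)%:E]].

Definition L_node D j :=
  forall (V : R) (H : nat -> (nat -> R) -> R) (n : nat)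
         (Vs : nat -> R) (Hs : nat -> nat -> (nat -> R) -> R),
    portfolio D j H -> (j <= n)%N ->
    (forall m, (1 <= m)%N -> admissible D j (Vs m) (Hs m)) ->
    (forall S, D S -> (wealth j n V H S)%:E <=
       \sum_(1 <= m <oo) liminf_wealth j (Vs m) (Hs m) S) ->
    V%:E <= \sum_(1 <= m <oo) (Vs m)%:E.

Definition sigma calS j (f : (nat -> R) -> \bar R) S : \bar R :=
  sigma_node (node calS S j) j f.

Definition Ibar calS (f : (nat -> R) -> \bar R) : \bar R := Ibar_node calS 0 f.

Definition null_subset calS E :=
  E `<=` calS /\ Ibar calS (fun S => (\1_E S)%:E) = 0.

Definition almost_everywhere_on calS (P : (nat -> R) -> Prop) :=
  null_subset calS [set S | calS S /\ ~ P S].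

Definition L_ae calS :=
  L_node calS 0 /\
  null_subset calS [set S | calS S /\ exists j, ~ L_node (node calS S j) j].

Definition supermartingale_on calS (f : nat -> (nat -> R) -> R) :=
  forall j, almost_everywhere_on calS
    (fun S => sigma calS j (fun T => (f j.+1 T)%:E) S <= (f j S)%:E).

End Trajectories.

(* Main.v *)
Require Import Defs.
From mathcomp Require Import all_boot all_order all_algebra.
From mathcomp Require Import all_classical all_reals all_analysis.
From mathcomp Require Import lra.
Import Order.TTheory GRing.Theory Num.Theory.
Import numFieldNormedType.Exports.

(** The decomposition is Doob's, except that prices defined by infima are
    attained only up to errors delta j, and that positions must be produced
    from hedges consisting of countably many strategies over an infinite
    horizon.

    Null sets are handled through explosive sets: N is null exactly when some
    sequence of admissible strategies of finite total capital has infinite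
    payoff on N (null_subsetP). Scaling makes the capital as small as desired,
    enumerating pairs of indices gives stability under countable unions, and
    restarting the strategies at a later node shows that, for almost every S,
    a null set is still explosive from the node (S, j) on
    (explosive_restart).

    From the decomposition to the supermartingale property: off N the
    decomposition gives a one-step hedge of f (j + 1) with capital
    f j + delta j, and the strategies exploding on N correct it on N at an
    arbitrarily small additional cost (sigma_le); then delta tends to 0.

    Conversely, let the price of f (j + 1) at (S, j) be less than
    f j S + delta j and take a hedge realizing this. Where (L) holds at
    time j + 1, what happens later can be discarded: the values of the
    strategies at time j + 1 already dominate f (j + 1) (hedge_one_step). If
    prices can both rise and fall from (S, j), nonnegativity of the strategies
    bounds their positions by their capital, so the positions sum to one
    number H j S (affine_series). Otherwise all moves have one sign, the
    nonzero ones form a null set of free gains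
    (explosive_arbitrage_move), and on the others no position is needed
    (sigma_one_step). The excluded trajectories never depend on delta. The
    slack in the resulting one-step inequalities is the increment of A. *)

Local Open Scope classical_set_scope.
Local Open Scope ring_scope.

(** * Wealth along nodes *)

Section Wealth.
Context {R : realType}.
Implicit Types (calS D : set (nat -> R)) (S T U : nat -> R).
Implicit Types (H : nat -> (nat -> R) -> R) (V : R).

Lemma node_le {calS S T j k} : (j <= k)%N -> node calS S j T ->
  node calS T k `<=` node calS S j.
Proof.
move=> jk [_ eST] U [SU eTU]; split => // i ij.
by rewrite eTU ?eST// (leq_trans ij).
Qed.

Lemma node_eq {calS S T j} : node calS S j T -> node calS T j = node calS S j.
Proof.
move=> [ST eST]; apply/seteqP; split => U [SU eU]; split => // i ij.
  by rewrite eU ?eST.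
by rewrite eU ?eST.
Qed.

Lemma node_refl {calS S j} : calS S -> node calS S j S.
Proof. by []. Qed.

Lemma node0 {calS s0 S} : trajectory_set s0 calS -> calS S ->
  node calS S 0 = calS.
Proof.
move=> hS SS; apply/seteqP; split => [T []//|T ST]; split => // i.
by rewrite leqn0 => /eqP ->; rewrite !hS.
Qed.

Lemma wealth_start j V H S : wealth j j V H S = V.
Proof. by rewrite /wealth big_geq ?addr0. Qed.

Lemma wealth_step j V H S :
  wealth j j.+1 V H S = V + H j S * (S j.+1 - S j).
Proof. by rewrite /wealth big_nat1. Qed.

Lemma wealth_restart j k n V H S : (j <= k)%N -> (k <= n)%N ->
  wealth j n V H S = wealth k n (wealth j k V H S) H S.
Proof. by move=> jk kn; rewrite /wealth (big_cat_nat jk kn) addrA. Qed.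

Lemma wealth_scale j n c V H S :
  wealth j n (c * V) (fun i T => c * H i T) S = c * wealth j n V H S.
Proof.
rewrite /wealth mulrDr big_distrr/=; congr (_ + _).
by apply: eq_bigr => i _; rewrite mulrA.
Qed.

Lemma wealth_stop j k n V H S :
  wealth j n V (fun i T => if (i < k)%N then H i T else 0) S =
  wealth j (minn n k) V H S.
Proof.
rewrite /wealth; congr (_ + _).
rewrite [RHS](big_nat_widen _ _ n) ?geq_minl// [RHS]big_mkcond/=.
apply: eq_big_nat => i /andP[_ lt_in]; rewrite leq_min lt_in/=.
by case: ifP; rewrite ?mul0r.
Qed.

Lemma portfolio_restart {calS S T j k H} : (j <= k)%N -> node calS S j T ->
  portfolio (node calS S j) j H -> portfolio (node calS T k) k H.
Proof.
move=> jk nT pH i U W ki nU nW e; apply: pH => //; first exact: leq_trans ki.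
- exact: (node_le jk nT).
- exact: (node_le jk nT).
move=> l /andP[jl li]; case: (leqP k l) => kl; first by apply: e; rewrite kl.
by case: nU nW => _ eU [_ eW]; rewrite eU 1?eW// ltnW.
Qed.

Lemma wealth_node {calS S T U j k V H} :
  portfolio (node calS S j) j H -> node calS S j T -> node calS T k U ->
  wealth j k V H U = wealth j k V H T.
Proof.
move=> pH nT [SU eU].
case: (leqP j k) => [jk|kj]; last by rewrite /wealth !big_geq// ltnW.
rewrite /wealth; congr (_ + _); apply: eq_big_nat => i /andP[ji ik].
rewrite (eU i.+1)// (eU i) ?(ltnW ik)//; congr (_ * _); apply: pH => //.
  by apply: (node_le jk nT).
by move=> l /andP[_ li]; rewrite eU// (leq_trans li)// ltnW.
Qed.

End Wealth.

(** * Lower limits and series of extended reals *)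

Section LowerLimit.
Context {R : realType}.
Local Open Scope ereal_scope.
Implicit Types (u v : (\bar R)^nat).

Lemma limn_einf_le_eventually {u v} k :
  (forall n, (k <= n)%N -> u n <= v n) -> limn_einf u <= limn_einf v.
Proof.
move=> uv; rewrite !limn_einf_lim; apply: lee_lim; [exact: is_cvg_einfs..|].
near=> n; apply: le_ereal_inf_tmp => _ [m /= nm <-].
apply: (@le_trans _ _ (u m)); first by apply: ereal_inf_lbound; exists m.
by apply: uv; apply: leq_trans nm; near: n; exact: nbhs_infty_ge.
Unshelve. all: by end_near. Qed.

Lemma limn_einf_eventually {u v} k :
  (forall n, (k <= n)%N -> u n = v n) -> limn_einf u = limn_einf v.
Proof.
move=> uv; apply/eqP; rewrite eq_le.
by apply/andP; split; apply: (limn_einf_le_eventually k) => n /uv ->.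
Qed.

Lemma limn_einf_cst (c : \bar R) : limn_einf (fun=> c) = c.
Proof.
by have [] := cvg_limn_einf_sup (@cvg_cst _ c nat \oo _).
Qed.

Lemma limn_einfZl u (c : R) : (0 < c)%R ->
  limn_einf (fun n => c%:E * u n) = c%:E * limn_einf u.
Proof.
move=> c0; rewrite !limn_einf_lim; apply/cvg_lim => //.
rewrite (_ : einfs _ = (fun n => c%:E * einfs u n)).
  exact: cvgeZl (is_cvg_einfs (u:=u)).
apply/funext => n; rewrite /einfs -ereal_inf_pZl//; congr ereal_inf.
by apply/seteqP; split => [_ [m nm <-]|_ [_ [m nm <-] <-]];
  [exists (u m) => //; exists m|exists m].
Qed.

(** Hedges are numbered from 1 because the index 0 is reserved for the
    elementary part of a price; the pure hedges below are numbered from 0. *)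
Lemma nneseries_from1 u : (forall m, (1 <= m)%N -> 0 <= u m) ->
  \sum_(1 <= m <oo) u m = \sum_(m <oo) u m.+1.
Proof.
move=> u0; apply/cvg_lim => //; rewrite -cvg_shiftS.
under eq_cvg do rewrite /= big_add1/=.
by apply: is_cvg_nneseries => n _ _; exact: u0.
Qed.

Lemma nneseries_bounded_below {u} {c : R} : (0 < c)%R ->
  (forall k, c%:E <= u k) -> \sum_(k <oo) u k = +oo.
Proof.
move=> c0 cu; apply/eqyP => A A0.
have u0 k : 0 <= u k by apply: le_trans (cu k); rewrite lee_fin ltW.
pose n := Num.bound (A / c).
apply: (@le_trans _ _ (\sum_(0 <= k < n) c%:E)).
  rewrite sumEFin lee_fin sumr_const_nat subn0 -mulr_natl -ler_pdivrMr//.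
  by apply: ltW; rewrite archi_boundP// divr_ge0// ltW.
apply: (@le_trans _ _ (\sum_(0 <= k < n) u k)).
  by apply: lee_sum => k _.
by apply: nneseries_lim_ge.
Qed.

(** One enumeration of the pairs serves all nonnegative double series at once,
    hence the capitals and, at every trajectory, the payoffs. *)
Lemma pair_enumeration : exists e : nat -> nat * nat,
  forall a : nat -> nat -> \bar R, (forall k m, 0 <= a k m) ->
  \sum_(n <oo) a (e n).1 (e n).2 = \sum_(k <oo) \sum_(m <oo) a k m.
Proof.
have /card_esym/pcard_eqP[e] := card_nat2.
exists e => a a0.
rewrite nneseries_esumT; last by move=> n; exact: a0.
rewrite -(@reindex_esum _ _ _ setT setT e (fun p => a p.1 p.2)); last first.
  exact: bij.
rewrite [RHS]nneseries_esumT; last first.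
  by move=> k; apply: nneseries_ge0 => *; exact: a0.
under [RHS]eq_esum do rewrite nneseries_esumT//.
rewrite esum_esum//; congr esum.
by apply/seteqP; split.
Qed.

End LowerLimit.

(** * Admissible strategies and explosive sets *)

Section Strategies.
Context {R : realType}.
Implicit Types (calS D N : set (nat -> R)) (S T U : nat -> R).
Implicit Types (H : nat -> (nat -> R) -> R) (V : R).
Implicit Types (Vs : nat -> R) (Hs : nat -> nat -> (nat -> R) -> R).
Local Open Scope ereal_scope.

Lemma admissibleI D j V H : portfolio D j H ->
  (forall n S, (j <= n)%N -> D S -> (0 <= wealth j n V H S)%R) ->
  admissible D j V H.
Proof.
move=> pH H0; split => // n jn; split; first by exists V, H, n.
by move=> S DS; exact: H0.
Qed.

Lemma admissible_ge0 {D j V H S} n : admissible D j V H -> D S ->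
  (0 <= wealth j n V H S)%R.
Proof.
move=> [_ aH] DS; have [jn|nj] := leqP j n; first by case: (aH n jn) => _; apply.
case: (aH j (leqnn j)) => _ /(_ S DS).
by rewrite /wealth !big_geq// ltnW.
Qed.

Lemma admissible_capital_ge0 {D j V H S} : admissible D j V H -> D S ->
  (0 <= V)%R.
Proof. by move=> aH /(admissible_ge0 j aH); rewrite wealth_start. Qed.

Lemma liminf_wealth_ge {j V H S k} (c : R) :
  (forall n, (k <= n)%N -> (c <= wealth j n V H S)%R) ->
  c%:E <= liminf_wealth j V H S.
Proof.
move=> cw; rewrite -(limn_einf_cst c%:E).
by apply: (limn_einf_le_eventually k) => n /cw; rewrite lee_fin.
Qed.

Lemma liminf_wealth_ge0 {D j V H S} : admissible D j V H -> D S ->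
  0 <= liminf_wealth j V H S.
Proof.
move=> aH DS; apply: (@liminf_wealth_ge _ _ _ _ 0) => n _.
exact: admissible_ge0 aH DS.
Qed.

Lemma admissible_scale D j (c : R) V H : (0 <= c)%R -> admissible D j V H ->
  admissible D j (c * V)%R (fun i T => c * H i T)%R.
Proof.
move=> c0 aH; apply: admissibleI => [i S T ji DS DT e|n S jn DS].
  by congr (_ * _)%R; apply: aH.1.
by rewrite wealth_scale mulr_ge0// (admissible_ge0 n aH).
Qed.

Lemma liminf_wealth_scale j (c : R) V H S : (0 < c)%R ->
  liminf_wealth j (c * V)%R (fun i T => c * H i T)%R S =
  c%:E * liminf_wealth j V H S.
Proof.
move=> c0; rewrite /liminf_wealth -limn_einfZl//.
by congr limn_einf; apply/funext => n; rewrite wealth_scale EFinM.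
Qed.

Lemma admissible_restart {calS S T j k V H} : (j <= k)%N ->
  node calS S j T -> admissible (node calS S j) j V H ->
  admissible (node calS T k) k (wealth j k V H T) H.
Proof.
move=> jk nT aH; apply: admissibleI => [|n U kn nU].
  exact: portfolio_restart jk nT aH.1.
rewrite -(wealth_node aH.1 nT nU) -wealth_restart//.
exact: admissible_ge0 aH (node_le jk nT _ nU).
Qed.

Lemma liminf_wealth_restart {calS S T U j k V H} : (j <= k)%N ->
  node calS S j T -> portfolio (node calS S j) j H -> node calS T k U ->
  liminf_wealth j V H U = liminf_wealth k (wealth j k V H T) H U.
Proof.
move=> jk nT pH nU; apply: (limn_einf_eventually k) => n kn.
by rewrite -(wealth_node pH nT nU) -wealth_restart.
Qed.

Definition hedge j Vs Hs T : \bar R :=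
  \sum_(m <oo) liminf_wealth j (Vs m) (Hs m) T.

Lemma hedge_ge0 {D j Vs Hs T} : (forall m, admissible D j (Vs m) (Hs m)) ->
  D T -> 0 <= hedge j Vs Hs T.
Proof.
by move=> aH DT; apply: nneseries_ge0 => m _ _; exact: liminf_wealth_ge0 DT.
Qed.

(** Countably many hedges become one sequence of strategies by enumerating
    pairs of indices; dyadic costs keep the total capital finite. *)
Lemma hedge_dyadic_union {D j S} {Vs : nat -> nat -> R}
    {Hs : nat -> nat -> nat -> (nat -> R) -> R} :
  D S -> (forall k m, admissible D j (Vs k m) (Hs k m)) ->
  (forall k, \sum_(m <oo) (Vs k m)%:E <= (1 / (2 ^ k.+1)%:R)%:E) ->
  exists Vs' Hs', [/\ forall m, admissible D j (Vs' m) (Hs' m),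
    \sum_(m <oo) (Vs' m)%:E < +oo &
    forall T, D T -> hedge j Vs' Hs' T = \sum_(k <oo) hedge j (Vs k) (Hs k) T].
Proof.
move=> DS aH sV; have [e eE] := @pair_enumeration R.
have V0 k m : 0 <= (Vs k m)%:E.
  by rewrite lee_fin (admissible_capital_ge0 (aH k m) DS).
exists (fun n => Vs (e n).1 (e n).2), (fun n => Hs (e n).1 (e n).2); split => //.
- apply: le_lt_trans (ltry 1); rewrite (eE (fun k m => (Vs k m)%:E))//.
  apply: le_trans (epsilon_trick0 xpredT ler01).
  by apply: lee_nneseries => // k _ _; exact: nneseries_ge0.
- move=> T DT; apply: (eE (fun k m => liminf_wealth j (Vs k m) (Hs k m) T)) => k m.
  exact: liminf_wealth_ge0 (aH k m) DT.
Qed.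

(** Infinite payoff on N at finite cost: this describes null sets without
    infima, and it makes sense at every node. *)
Definition explosive D j N := exists Vs Hs,
  [/\ forall m, admissible D j (Vs m) (Hs m), \sum_(m <oo) (Vs m)%:E < +oo &
      forall T, D T -> N T -> hedge j Vs Hs T = +oo].

(** An infinite payoff is invariant under scaling, whereas the cost is not. *)
Lemma explosive_cheap {D j N S} (eps : R) : D S -> explosive D j N ->
  (0 < eps)%R -> exists Vs Hs,
  [/\ forall m, admissible D j (Vs m) (Hs m), \sum_(m <oo) (Vs m)%:E <= eps%:E &
      forall T, D T -> N T -> hedge j Vs Hs T = +oo].
Proof.
move=> DS [Vs [Hs [aH Vfin Hoo]]] e0.
have V0 m : 0 <= (Vs m)%:E by rewrite lee_fin (admissible_capital_ge0 (aH m) DS).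
have : 0 <= \sum_(m <oo) (Vs m)%:E by apply: nneseries_ge0.
case E : (\sum_(m <oo) _) Vfin => [v| |]// _; rewrite lee_fin => v0.
have c0 : (0 < eps / (v + 1))%R by rewrite divr_gt0// ltr_wpDl.
exists (fun m => eps / (v + 1) * Vs m)%R,
  (fun m i T => eps / (v + 1) * Hs m i T)%R; split.
- by move=> m; apply: admissible_scale (aH m); exact: ltW.
- under eq_eseriesr do rewrite EFinM.
  rewrite nneseriesZl// E -EFinM lee_fin -mulrA ger_pMr//.
  by rewrite mulrC ler_pdivrMr ?ltr_wpDl// mul1r lerDl.
move=> T DT NT; rewrite /hedge; under eq_eseriesr do rewrite liminf_wealth_scale//.
rewrite nneseriesZl => [|m _]; last exact: liminf_wealth_ge0 (aH m) DT.
by have := Hoo T DT NT; rewrite /hedge => ->; rewrite mulry gtr0_sg// mul1e.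
Qed.

Lemma explosive_bigcup {D j S} (N : nat -> set (nat -> R)) : D S ->
  (forall k, explosive D j (N k)) -> explosive D j (\bigcup_k N k).
Proof.
move=> DS eN.
have /choice[Vs /choice[Hs VH]] k :=
  explosive_cheap (1 / (2 ^ k.+1)%:R) DS (eN k) ltac:(by rewrite divr_gt0).
have aH k m : admissible D j (Vs k m) (Hs k m) by case: (VH k).
have sV k : \sum_(m <oo) (Vs k m)%:E <= (1 / (2 ^ k.+1)%:R)%:E by case: (VH k).
have [Vs' [Hs' [aH' sV' sH]]] := hedge_dyadic_union DS aH sV.
exists Vs', Hs'; split => // T DT [k _ NT].
rewrite sH//; apply: (@nneseries_pinfty _ _ _ k) => // [n _|].
  exact: hedge_ge0 (aH n) DT.
by case: (VH k) => _ _; apply.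
Qed.

End Strategies.

(** * Null sets *)

Section NullSets.
Context {R : realType}.
Implicit Types (calS D N : set (nat -> R)) (S T U : nat -> R).
Implicit Types (H : nat -> (nat -> R) -> R) (V : R).
Implicit Types (Vs : nat -> R) (Hs : nat -> nat -> (nat -> R) -> R).
Local Open Scope ereal_scope.

Lemma hedge_from1 {D j Vs Hs T} :
  (forall m, (1 <= m)%N -> admissible D j (Vs m) (Hs m)) -> D T ->
  \sum_(1 <= m <oo) liminf_wealth j (Vs m) (Hs m) T =
  hedge j (fun m => Vs m.+1) (fun m => Hs m.+1) T.
Proof.
move=> aH DT; rewrite nneseries_from1// => m m1.
exact: liminf_wealth_ge0 (aH m m1) DT.
Qed.

Lemma capital_from1 {D j Vs Hs S} :
  (forall m, (1 <= m)%N -> admissible D j (Vs m) (Hs m)) -> D S ->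
  \sum_(1 <= m <oo) (Vs m)%:E = \sum_(m <oo) (Vs m.+1)%:E.
Proof.
move=> aH DS; rewrite (@nneseries_from1 _ (fun m => (Vs m)%:E))// => m m1.
by rewrite lee_fin (admissible_capital_ge0 (aH m m1) DS).
Qed.

(** Hedging the indicator of N countably often, the k-th time at cost
    at most 1 / 2 ^ (k + 1), pays infinitely often at least 1 on N. *)
Lemma Ibar_node_explosive {D j S} N : D S ->
  Ibar_node D j (fun T => (\1_N T)%:E) = 0 -> explosive D j N.
Proof.
move=> DS IN.
have /choice[Vs /choice[Hs VH]] k : exists Vs Hs,
    [/\ forall m, admissible D j (Vs m) (Hs m),
        \sum_(m <oo) (Vs m)%:E <= (1 / (2 ^ k.+1)%:R)%:E &
        forall T, D T -> N T -> 1 <= hedge j Vs Hs T].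
  have : Ibar_node D j (fun T => (\1_N T)%:E) < (1 / (2 ^ k.+1)%:R)%:E.
    by rewrite IN lte_fin divr_gt0.
  move=> /ereal_inf_lt[_ [Vs [Hs [aH fH ->]]] /ltW].
  rewrite (capital_from1 aH DS) => VH.
  exists (fun m => Vs m.+1), (fun m => Hs m.+1); split => //.
    by move=> m; exact: aH.
  move=> T DT NT; have := fH T DT; rewrite (hedge_from1 aH DT).
  by rewrite indicE mem_set.
have aH k m : admissible D j (Vs k m) (Hs k m) by case: (VH k).
have sV k : \sum_(m <oo) (Vs k m)%:E <= (1 / (2 ^ k.+1)%:R)%:E by case: (VH k).
have [Vs' [Hs' [aH' sV' sH]]] := hedge_dyadic_union DS aH sV.
exists Vs', Hs'; split => // T DT NT.
rewrite sH//; apply: (nneseries_bounded_below ltr01) => k.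
by case: (VH k) => _ _; apply.
Qed.

Lemma explosive_Ibar_node {D j S} N : D S -> N `<=` D -> explosive D j N ->
  Ibar_node D j (fun T => (\1_N T)%:E) = 0.
Proof.
move=> DS ND eN; apply/eqP; rewrite eq_le; apply/andP; split.
  apply/lee_addgt0Pr => eps e0; rewrite add0e.
  have [Vs [Hs [aH sV sH]]] := explosive_cheap _ DS eN e0.
  apply: le_trans sV; apply: ereal_inf_lbound.
  have aH' m : (1 <= m)%N -> admissible D j (Vs m.-1) (Hs m.-1) by [].
  exists (fun m => Vs m.-1), (fun m => Hs m.-1); split => //.
    move=> T DT; rewrite (hedge_from1 aH' DT) indicE.
    have [/set_mem NT|_] := boolP (T \in N); last exact: hedge_ge0 aH DT.
    by rewrite /= sH// leey.
  by rewrite (capital_from1 aH' DS).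
apply: le_ereal_inf_tmp => _ [Vs [Hs [aH _ ->]]].
rewrite (capital_from1 aH DS); apply: nneseries_ge0 => m _ _.
by rewrite lee_fin (admissible_capital_ge0 (aH m.+1 _) DS).
Qed.

Lemma null_subsetP {calS S} N : calS S ->
  null_subset calS N <-> N `<=` calS /\ explosive calS 0 N.
Proof.
move=> SS; split => -[NS eN]; split => //.
  exact: Ibar_node_explosive SS eN.
exact: explosive_Ibar_node SS NS eN.
Qed.

Lemma explosive_sub {D j} N N' : N `<=` N' -> explosive D j N' ->
  explosive D j N.
Proof.
move=> NN' [Vs [Hs [aH sV sH]]]; exists Vs, Hs; split => // T DT /NN'.
exact: sH.
Qed.

Lemma explosiveU {D j S} N N' : D S -> explosive D j N -> explosive D j N' ->
  explosive D j (N `|` N').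
Proof.
move=> DS eN eN'.
apply: explosive_sub (explosive_bigcup (fun k => if k is 0 then N else N') DS _).
  by move=> T [NT|NT]; [exists 0%N|exists 1%N].
by case.
Qed.

(** Restarting at time j the strategies that explode on N costs the wealth
    accumulated at time j; the nodes where this cost is infinite are covered
    by the same strategies stopped at time j. *)
Lemma explosive_restart {calS s0} N j : trajectory_set s0 calS ->
  explosive calS 0 N ->
  exists M, [/\ M `<=` calS, explosive calS 0 M &
    forall S, (calS `\` M) S -> explosive (node calS S j) j N].
Proof.
move=> hS [Vs [Hs [aH sV sH]]].
(* M collects the trajectories whose node at time j is too expensive. *)
exists [set S | calS S /\ \sum_(m <oo) (wealth 0 j (Vs m) (Hs m) S)%:E = +oo].
split; first by move=> S [].
- exists Vs, (fun m i T => if (i < j)%N then Hs m i T else 0%R); split => //.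
    move=> m; apply: admissibleI => [i S T _ SS ST e|n S _ SS].
      by case: ifP => // _; apply: (aH m).1.
    by rewrite wealth_stop (admissible_ge0 _ (aH m) SS).
  move=> S SS [_ Soo]; apply/eqP; rewrite eq_le leey/= -Soo.
  apply: lee_nneseries => [m _ _|m _].
    by rewrite lee_fin (admissible_ge0 _ (aH m) SS).
  apply: (liminf_wealth_ge (k := j)) => n jn.
  by rewrite wealth_stop (minn_idPr jn).
move=> S [SS nM].
have aH0 m : admissible (node calS S 0) 0 (Vs m) (Hs m).
  by rewrite (node0 hS SS); exact: aH.
exists (fun m => wealth 0 j (Vs m) (Hs m) S), Hs; split.
- by move=> m; exact: admissible_restart (leq0n j) (node_refl SS) (aH0 m).
- by rewrite ltey; apply/eqP => Soo; apply: nM.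
move=> T nT NT; rewrite -(sH T nT.1 NT).
apply: eq_eseriesr => m _; apply/esym.
exact: liminf_wealth_restart (leq0n j) (node_refl SS) (aH0 m).1 nT.
Qed.

End NullSets.

(** * One-step hedges *)

Section OneStep.
Context {R : realType}.
Implicit Types (calS D N : set (nat -> R)) (S T U : nat -> R).
Implicit Types (H : nat -> (nat -> R) -> R) (V : R) (g : (nat -> R) -> R).
Implicit Types (Vs : nat -> R) (Hs : nat -> nat -> (nat -> R) -> R).

Definition rises calS j S := exists2 T, node calS S j T & T j < T j.+1.
Definition falls calS j S := exists2 T, node calS S j T & T j.+1 < T j.

(** At a node with rising and falling continuations the positions of
    admissible strategies are controlled by their capital. At any other node
    all price moves have the same sign, and holding the asset in that
    direction turns every nonzero move into a free gain. *)
Definition arbitrage_move calS j : set (nat -> R) :=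
  [set S | [/\ calS S, S j.+1 != S j & ~ (rises calS j S /\ falls calS j S)]].

(** Infinitely many copies of the position h below, which costs nothing and
    never loses, gain infinitely much on an arbitrage move. *)
Lemma explosive_arbitrage_move {calS s0} j : trajectory_set s0 calS ->
  explosive calS 0 (arbitrage_move calS j).
Proof.
move=> hS.
pose h S : R := if `[< falls calS j S >] then
  if `[< rises calS j S >] then 0 else -1 else 1.
have hge0 S : calS S -> 0 <= h S * (S j.+1 - S j).
  move=> SS; have [lt_S|gt_S|->] := ltgtP (S j) (S j.+1); last first.
  - by rewrite subrr mulr0.
  - rewrite /h asboolT; last by exists S.
    by case: ifP => _; rewrite ?mul0r// mulN1r opprB subr_ge0 ltW.
  - rewrite /h (asboolT (_ : rises calS j S)); last by exists S.
    by case: ifP => _; rewrite ?mul0r// mul1r subr_ge0 ltW.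
have hgt0 S : arbitrage_move calS j S -> 0 < h S * (S j.+1 - S j).
  move=> [SS neS nS]; rewrite lt0r hge0// andbT mulf_neq0 ?subr_eq0//.
  rewrite /h; case: asboolP => [fS|_]; last exact: oner_neq0.
  rewrite asboolF ?oppr_eq0 ?oner_neq0// => rS; exact: nS.
pose H i S : R := if i == j then h S else 0.
have wH n S : wealth 0 n 0 H S = if (j < n)%N then h S * (S j.+1 - S j) else 0.
  rewrite /wealth add0r.
  transitivity (\sum_(0 <= i < n | i == j) h S * (S i.+1 - S i)); last first.
    exact: big_nat1_eq.
  rewrite [RHS]big_mkcond; apply: eq_bigr => i _.
  by rewrite /H; case: ifP => [/eqP ->//|]; rewrite mul0r.
exists (fun=> 0), (fun=> H); split => [_||S SS aS].
- apply: admissibleI => [i S T _ SS ST e|n S _ SS].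
    rewrite /H; case: eqP => // ij; rewrite /h.
    have ST' : node calS S j T by split => // l lj; rewrite e ?ij.
    by rewrite /falls /rises (node_eq ST').
  by rewrite wH; case: ifP => // _; exact: hge0.
- by rewrite eseries0// ltry.
- apply: (nneseries_bounded_below (hgt0 S aS)) => k.
  by apply: (liminf_wealth_ge (k := j.+1)) => n jn; rewrite wH jn.
Qed.

Local Open Scope ereal_scope.

(** Nonnegativity at one positive and one negative increment bounds the slopes
    h m by a constant times v m, so that the positions of countably many
    strategies add up to a single position k. *)
Lemma affine_series {v h : nat -> R} {a b : R} : (0 < a)%R -> (0 < b)%R ->
  (forall m, 0 <= v m)%R ->
  (forall m, 0 <= v m + h m * b)%R -> (forall m, 0 <= v m - h m * a)%R ->
  \sum_(m <oo) (v m)%:E < +oo ->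
  exists k : R, forall x : R, \sum_(m <oo) (v m + h m * x)%:E =
    \sum_(m <oo) (v m)%:E + (k * x)%:E.
Proof.
move=> a0 b0 v0 hb ha vfin.
have cv := nnseries_is_cvg v0 vfin.
have ch : cvgn (series h).
  apply: normed_cvg.
  apply: (@series_le_cvg _ _ (fun m => v m * (a^-1 + b^-1)))%R => [m|m|m|].
  - exact: normr_ge0.
  - by rewrite mulr_ge0// addr_ge0// invr_ge0 ltW.
  - have hl : (- (v m / b) <= h m)%R.
      by rewrite -mulNr ler_pdivrMr// -subr_ge0 opprK addrC.
    have hu : (h m <= v m / a)%R by rewrite ler_pdivlMr// -subr_ge0.
    have va : (0 <= v m / a)%R by rewrite divr_ge0// ltW.
    have vb : (0 <= v m / b)%R by rewrite divr_ge0// ltW.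
    by rewrite mulrDr ler_norml; apply/andP; split; lra.
  - rewrite (_ : (fun _ => _) = (a^-1 + b^-1)%R *: v).
      exact: is_cvg_seriesZ cv.
    by apply/funext => m; rewrite mulrC.
have limE (u : nat -> R) : cvgn (series u) ->
    \sum_(m <oo) (u m)%:E = (limn (series u))%:E.
  move=> cu; rewrite -EFin_lim//.
  rewrite (_ : EFin \o _ = (fun n => \sum_(0 <= m < n) (u m)%:E))//.
  by apply/funext => n; rewrite /= sumEFin.
exists (limn (series h)) => x.
rewrite (eq_eseriesr (g := fun m => ((v + x *: h)%R m)%:E)); last first.
  by move=> m _; congr (_ + _)%:E; exact: mulrC.
have cxh : cvgn (series (x *: h)) := is_cvg_seriesZ ch.
rewrite (limE (v + x *: h)%R (is_cvg_seriesD cv cxh)) (limE v cv) -EFinD.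
by rewrite lim_seriesD// lim_seriesZ// [(_ * x)%R]mulrC.
Qed.

(** The initial term may be negative: it will be the initial capital of the
    elementary part of a hedge. *)
Lemma eseries_recl {u : nat -> \bar R} : u 0%N \is a fin_num ->
  (forall m, 0 <= u m.+1) -> \sum_(m <oo) u m = u 0%N + \sum_(m <oo) u m.+1.
Proof.
move=> u0 uS; apply/cvg_lim => //; rewrite -cvg_shiftS.
under eq_cvg do rewrite /= big_nat_recl//.
apply: cvgeD; [by rewrite fin_num_adde_defr|exact: cvg_cst|].
by apply: is_cvg_nneseries => m _ _.
Qed.

Lemma portfolio_stop {D j H} n : portfolio D j H ->
  portfolio D j (fun i T => if (i < n)%N then H i T else 0%R).
Proof. by move=> pH i S T ji DS DT e; case: ifP => // _; exact: pH. Qed.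

Lemma wealthB j n V H S (c : R) :
  wealth j n (c - V)%R (fun i T => - H i T)%R S = (c - wealth j n V H S)%R.
Proof.
rewrite /wealth opprD addrA; congr (_ + _)%R; rewrite -sumrN.
by apply: eq_bigr => i _; rewrite mulNr.
Qed.

(** Property (L) at the node (T, j + 1) shortens an infinite-horizon hedge to
    one step: restarted at that node, the nonnegative strategies dominate the
    elementary function g T minus the wealth of H, hence their restart capital
    dominates the capital of this function. *)
Lemma hedge_one_step {calS S T j V n0 g H Vs Hs} :
  portfolio (node calS S j) j H -> (j < n0)%N ->
  (forall m, admissible (node calS S j) j (Vs m) (Hs m)) ->
  (forall U, node calS S j U ->
    (g U)%:E <= (wealth j n0 V H U)%:E + hedge j Vs Hs U) ->
  node calS S j T -> (forall U, node calS T j.+1 U -> g U = g T) ->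
  L_node (node calS T j.+1) j.+1 ->
  (g T)%:E <= (wealth j j.+1 V H T)%:E +
              \sum_(m <oo) (wealth j j.+1 (Vs m) (Hs m) T)%:E.
Proof.
move=> pH jn aH gH nT gT L.
have nTT : node calS T j.+1 T by exact: node_refl nT.1.
pose Vs' m := wealth j j.+1 (Vs m.-1) (Hs m.-1) T.
have aH' m : (1 <= m)%N ->
    admissible (node calS T j.+1) j.+1 (Vs' m) (Hs m.-1).
  by move=> _; exact: admissible_restart (leqnSn j) nT (aH m.-1).
rewrite -leeBlDl// -EFinB -(capital_from1 aH' nTT).
apply: (L _ (fun i U => - H i U)%R n0 Vs' (fun m => Hs m.-1)) => // [|U nU].
  move=> i U W ji nU nW e; congr (- _)%R.
  exact: (portfolio_restart (leqnSn j) nT pH).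
rewrite (hedge_from1 aH' nU) wealthB -(wealth_node pH nT nU).
rewrite -wealth_restart// -(gT U nU) EFinB leeBlDl//.
have nU' := node_le (leqnSn j) nT _ nU.
rewrite (_ : hedge _ _ _ _ = hedge j Vs Hs U); first exact: gH.
apply: eq_eseriesr => m _; apply/esym.
exact: liminf_wealth_restart (leqnSn j) nT (aH m).1 nU.
Qed.

End OneStep.

(** * Prices and one-step hedges *)

Section OneStepSigma.
Context {R : realType}.
Implicit Types (calS D N : set (nat -> R)) (S T U : nat -> R).
Implicit Types (H : nat -> (nat -> R) -> R) (V c : R) (g : (nat -> R) -> R).
Local Open Scope ereal_scope.

(** After an arbitrage move the price may not be affordable by any single
    position, because the positions of the strategies need not be summable at
    such a node; a single position suffices for all other continuations. *)
Lemma sigma_one_step {calS S j c g} : calS S ->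
  sigma calS j (fun T => (g T)%:E) S < c%:E ->
  exists k : R, forall T, node calS S j T ->
    (forall U, node calS T j.+1 U -> g U = g T) ->
    L_node (node calS T j.+1) j.+1 -> ~ arbitrage_move calS j T ->
    (g T <= c + k * (T j.+1 - T j))%R.
Proof.
move=> SS /ereal_inf_lt[_ [Vs0 [Hs0 [n0 [[pH0 jn0] aH0 gH0 ->]]]] costc].
have nS : node calS S j S by exact: node_refl.
pose V := Vs0 0%N.
pose H := fun i T => if (i < n0)%N then Hs0 0%N i T else 0%R.
(* A hedge with n0 = j is stopped at time j and regarded as one that trades
   up to time j + 1. *)
pose n := maxn n0 j.+1.
pose Vs m := Vs0 m.+1; pose Hs m := Hs0 m.+1.
have pH : portfolio (node calS S j) j H by exact: portfolio_stop.
have aH m : admissible (node calS S j) j (Vs m) (Hs m) by exact: aH0.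
have gH U : node calS S j U ->
    (g U)%:E <= (wealth j n V H U)%:E + hedge j Vs Hs U.
  move=> nU; rewrite wealth_stop (minn_idPr (leq_maxl _ _)).
  by rewrite -(hedge_from1 aH0 nU); exact: gH0.
have Vs_ge0 m : (0 <= Vs m)%R := admissible_capital_ge0 (aH m) nS.
have jn : (j < n)%N by exact: leq_maxr.
have step T : node calS S j T -> (forall U, node calS T j.+1 U -> g U = g T) ->
    L_node (node calS T j.+1) j.+1 ->
    (g T)%:E <= (V + H j S * (T j.+1 - T j))%:E +
      \sum_(m <oo) (Vs m + Hs m j S * (T j.+1 - T j))%:E.
  move=> nT gT L; have := hedge_one_step pH jn aH gH nT gT L.
  have jE H' : portfolio (node calS S j) j H' -> H' j T = H' j S.
    by move=> pH'; apply: pH' => // k /andP[_]; exact: nT.2.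
  rewrite wealth_step jE//.
  by under eq_eseriesr => m do rewrite wealth_step (jE _ (aH m).1).
move: costc; rewrite eseries_recl// -/V => costc.
have : 0 <= \sum_(m <oo) (Vs m)%:E by apply: nneseries_ge0 => m _ _; rewrite lee_fin.
move: costc; rewrite -/Vs; case E : (\sum_(m <oo) (Vs m)%:E) => [v| |]// costc _.
have [[[T1 nT1 up] [T2 nT2 down]]|nrf] := pselect (rises calS j S /\ falls calS j S).
  have move_ge0 T m : node calS S j T ->
      (0 <= Vs m + Hs m j S * (T j.+1 - T j))%R.
    move=> nT; have := admissible_ge0 j.+1 (aH m) nT; rewrite wealth_step.
    rewrite (_ : Hs m j T = Hs m j S)//; apply: (aH m).1 => // k /andP[_].
    exact: nT.2.
  have [||//|m|m||k kE] := @affine_series _ Vs (fun m => Hs m j S)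
    (T2 j - T2 j.+1) (T1 j.+1 - T1 j); rewrite ?subr_gt0//.
  - exact: move_ge0.
  - by rewrite -mulrN opprB; exact: move_ge0.
  - by rewrite E ltry.
  exists (H j S + k)%R => T nT gT L _; have := step T nT gT L.
  rewrite kE E -!EFinD lee_fin => /le_trans; apply.
  by move: costc; rewrite -EFinD lte_fin mulrDl; lra.
(* All remaining moves are zero, so no position is needed. *)
exists 0%R => T nT gT L nA; have := step T nT gT L.
have -> : T j.+1 = T j.
  apply/eqP/negP => neT; apply: nA; split; [exact: nT.1|exact/negP|].
  by rewrite /rises /falls (node_eq nT).
rewrite subrr !mulr0 !addr0; under eq_eseriesr do rewrite mulr0 addr0.
rewrite E -EFinD lee_fin => /le_trans; apply.
by apply: ltW; move: costc; rewrite -EFinD lte_fin.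
Qed.

(** A one-step hedge outside N extends to the whole node at an arbitrarily
    small additional cost, by strategies that explode on N. *)
Lemma sigma_le {calS S j c g H N} : calS S ->
  explosive (node calS S j) j N -> portfolio (node calS S j) j H ->
  (forall T, node calS S j T -> ~ N T -> g T <= c + H j T * (T j.+1 - T j))%R ->
  sigma calS j (fun T => (g T)%:E) S <= c%:E.
Proof.
move=> SS eN pH gH; apply/lee_addgt0Pr => eps e0.
have nS : node calS S j S by exact: node_refl.
have [Vs [Hs [aH sV sH]]] := explosive_cheap _ nS eN e0.
apply: (@le_trans _ _ (c%:E + \sum_(m <oo) (Vs m)%:E)); last exact: leeD.
pose Vs' m := if m is m'.+1 then Vs m' else c.
pose Hs' m := if m is m'.+1 then Hs m' else H.
have aH' m : (1 <= m)%N -> admissible (node calS S j) j (Vs' m) (Hs' m).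
  by case: m => // m _; exact: aH.
apply: ereal_inf_lbound; exists Vs', Hs', j.+1; split => // [T nT|].
  rewrite (hedge_from1 aH' nT) wealth_step/=.
  have [NT|nNT] := pselect (N T); first by rewrite sH// addey// leey.
  apply: (@le_trans _ _ (c + H j T * (T j.+1 - T j))%:E).
    by rewrite lee_fin; exact: gH.
  by rewrite leeDl// (hedge_ge0 aH nT).
rewrite [RHS]eseries_recl// => m /=.
by rewrite lee_fin (admissible_capital_ge0 (aH m) nS).
Qed.

End OneStepSigma.

(** * The exceptional set of a supermartingale *)

Section Exceptional.
Context {R : realType}.
Implicit Types (calS N : set (nat -> R)) (S T U : nat -> R).

(** On the empty set every inequality between payoffs holds, so that capital 1
    could be dominated at no cost. *)
Lemma L_node_nonempty {D : set (nat -> R)} : L_node D 0 -> exists S, D S.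
Proof.
move=> L; apply: contrapT => nD.
have D0 S : D S -> False by move=> DS; apply: nD; exists S.
suff : (1%:E <= \sum_(1 <= m <oo) (0 : R)%:E)%E.
  by rewrite eseries0// lee_fin ler10.
apply: (L 1 (fun _ _ => 0) 0%N (fun=> 0) (fun _ _ _ => 0)) => // [m _|S /D0//].
by apply: admissibleI => // n S _ /D0.
Qed.

(** The exceptional set consists of the failures of (L), of the failures of
    the supermartingale inequality, and of the arbitrage moves. None of these
    involves the error c, which is why one set serves all errors. *)
Lemma supermartingale_exceptional_set {calS s0 S0 f} :
  trajectory_set s0 calS -> calS S0 ->
  null_subset calS [set S | calS S /\ exists j, ~ L_node (node calS S j) j] ->
  non_anticipative calS f -> supermartingale_on calS f ->
  exists N, [/\ N `<=` calS, explosive calS 0 N &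
    forall S j c, calS S -> ~ N S -> 0 < c ->
    exists k : R, forall T, node calS S j T -> ~ N T ->
      f j.+1 T <= f j S + c + k * (T j.+1 - T j)].
Proof.
move=> hS SS0 /(null_subsetP _ SS0)[NL eL] hf supf.
pose E j := [set S | calS S /\
  ~ (sigma calS j (fun T => (f j.+1 T)%:E) S <= (f j S)%:E)%E].
pose NLset := [set S | calS S /\ exists j, ~ L_node (node calS S j) j].
exists (NLset `|` \bigcup_j (E j `|` arbitrage_move calS j)); split.
- by move=> S [[]//|[j _ [[]//|[]//]]].
- apply: (explosiveU _ _ SS0) => //; apply: (explosive_bigcup _ SS0) => j.
  apply: (explosiveU _ _ SS0); last exact: explosive_arbitrage_move hS.
  by have /(null_subsetP _ SS0)[] := supf j.
move=> S j c SS nN c0.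
have sig : (sigma calS j (fun T => (f j.+1 T)%:E) S < (f j S + c)%:E)%E.
  apply: (@le_lt_trans _ _ (f j S)%:E); last by rewrite lte_fin ltrDl.
  by apply: contrapT => nsig; apply: nN; right; exists j => //; left.
have [k kP] := sigma_one_step SS sig; exists k => T nT nNT.
apply: kP => // [U [SU eU]||aT].
- by apply: hf => // ; exact: nT.1.
- apply: contrapT => nL; apply: nNT; left; split; first exact: nT.1.
  by exists j.+1.
- by apply: nNT; right; exists j => //; right.
Qed.

End Exceptional.

(** * Doob decomposition *)

Theorem theorem4p1 (R : realType) (s0 : R) (calS : set (nat -> R))
    (hS : trajectory_set s0 calS) (hL : L_ae calS)
    (f : nat -> (nat -> R) -> R) (hf : non_anticipative calS f) :
  supermartingale_on calS f <->
  exists2 N : set (nat -> R), null_subset calS N &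
    forall delta : nat -> R, (forall j, 0 < delta j) ->
    exists H A : nat -> (nat -> R) -> R,
      [/\ non_anticipative calS H,
          non_anticipative calS A,
          forall S, calS S -> nondecreasing_seq (fun j => A j S),
          forall S, calS S -> A 0%N S = 0 &
          forall S i, (calS `\` N) S ->
            f i S = f 0%N S + \sum_(0 <= j < i) H j S * (S j.+1 - S j)
                    - A i S + \sum_(0 <= j < i) delta j].
Proof.
have [S0 SS0] := L_node_nonempty hL.1.
split=> [supf|[N /(null_subsetP _ SS0)[NS eN] decomp] j].
  have [N [NS eN stepN]] := supermartingale_exceptional_set hS SS0 hL.2 hf supf.
  exists N; first by apply/(null_subsetP _ SS0).
  move=> delta delta0.
  pose P j S := [set k : R | forall T, node calS S j T -> ~ N T ->
    f j.+1 T <= f j S + delta j + k * (T j.+1 - T j)].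
  (* P j S depends on S only through the node (S, j); choosing from it by a
     fixed choice function makes H non-anticipative. *)
  pose H j S : R := xget 0 (P j S).
  have HP j S : calS S -> P j S !=set0 -> P j S (H j S).
    by move=> SS [k Pk]; exact: (xgetPex 0 (ex_intro _ k Pk)).
  (* Off N the maximum is its second argument; taking it makes A
     nondecreasing on all of calS. *)
  pose a j S := Num.max 0 (f j S + delta j + H j S * (S j.+1 - S j) - f j.+1 S).
  pose A i S := \sum_(0 <= j < i) a j S.
  have Hna : non_anticipative calS H.
    move=> j S T SS ST e; rewrite /H; congr xget.
    have nT : node calS S j T by split => // i ij; rewrite e.
    by rewrite /P (node_eq nT) (hf _ _ _ SS ST e).
  exists H, A; split => //.
  - move=> i S T SS ST e; apply: eq_big_nat => j /andP[_ ji].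
    have ej l : (l <= j)%N -> S l = T l.
      by move=> lj; rewrite e// (leq_trans lj)// ltnW.
    rewrite /a (hf j S T)// (hf j.+1 S T)// ?(Hna j S T)// ?(e j.+1)// ?(ej j)//.
    by move=> l lj; rewrite e// (leq_trans lj).
  - move=> S SS; apply/nondecreasing_seqP => i.
    by rewrite /A big_nat_recr//= lerDl le_max lexx.
  - by move=> S SS; rewrite /A big_geq.
  move=> S i [SS nN].
  have aE j : a j S = f j S + delta j + H j S * (S j.+1 - S j) - f j.+1 S.
    apply/max_idPr; rewrite subr_ge0; apply: HP => //.
    exact: stepN.
  rewrite /A (eq_bigr _ (fun j _ => aE j)).
  elim: i => [|i IH]; first by rewrite !big_geq// !addr0 subr0.
  by rewrite !big_nat_recr//=; lra.
have [M [MS eM expM]] := explosive_restart N j hS eN.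
apply/(null_subsetP _ SS0); split; first by move=> S [].
apply: explosive_sub eM => S [SS nsig]; apply: contrapT => nM; apply: nsig.
apply/lee_addgt0Pr => eps e0; rewrite -EFinD.
have [H [A [Hna _ Amon _ Hf]]] := decomp (fun=> eps) (fun=> e0).
apply: (sigma_le (H := H) SS (expM S _)) => // [i T U ji nT nU e|T nT nNT].
  apply: Hna; [exact: nT.1|exact: nU.1|move=> l li].
  have [lj|jl] := leqP j l; first by rewrite e ?lj.
  by rewrite nT.2 ?nU.2// ltnW.
have ST := nT.1.
have := Hf T j.+1 (conj ST nNT); have := Hf T j (conj ST nNT).
rewrite (hf j T S)//; last exact: nT.2.
have := Amon T ST j j.+1 (leqnSn j).
by rewrite !big_nat_recr//=; lra.
Qed.
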